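(* If $G$ is a connected betweenness-uniform graph of diameter at least $3$, then $B(G)\ge 1$.
   Context: All graphs are finite, simple, undirected, with nonempty vertex set. For distinct vertices $v,w$ of a connected graph $G$, let $\sigma_{vw}$ be the number of shortest paths between $v$ and $w$, and $\sigma_{vw}(x)$ the number of those containing $x$ as an internal vertex (so $\sigma_{vw}(x)=0$ if $x\in\{v,w\}$). The betweenness of a vertex $x$ is $B_G(x)=\sum_{\{v,w\}\subseteq V(G)}\frac{\sigma_{vw}(x)}{\sigma_{vw}}$, the sum being over unordered pairs of distinct vertices, and $B(G)=\frac{1}{|V(G)|}\sum_{x\in V(G)}B_G(x)$. $G$ is betweenness-uniform (a BUG) if $B_G(x)=B_G(y)$ for all $x,y\in V(G)$ (so $B(G)$ is the common value). *)

(* Defs.v *)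
(* A finite simple graph is a symmetric irreflexive relation
   [e : rel T] on a finite type [T] of vertices. *)
From mathcomp Require Import all_boot all_order all_algebra.

Set Implicit Arguments.
Unset Strict Implicit.
Unset Printing Implicit Defensive.

Import Order.TTheory GRing.Theory Num.Theory.
Local Open Scope ring_scope.

Section Graph.
Variables (T : finType) (e : rel T).

Definition connected_graph : Prop := forall v w : T, connect e v w.

(* The path with vertices v, p_1, ..., p_n = w is encoded by the sequence p of
   its vertices other than v, so that [size p] is its length. *)
Definition path_between (v w : T) (p : seq T) : bool :=
  [&& path e v p, last v p == w & uniq (v :: p)].

(* The least length of a path between v and w. A path has length less than
   #|T|; when there is none, [dist v w] takes the junk value #|T|. *)
Definition dist (v w : T) : nat :=
  find (fun n : nat => [exists p : n.-tuple T, path_between v w p])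
       (iota 0 #|T|).

Definition diameter : nat := (\max_(v : T) \max_(w : T) dist v w)%N.

Definition shortest_paths (v w : T) : {set (dist v w).-tuple T} :=
  [set p : (dist v w).-tuple T | path_between v w p].

Definition sigma (v w : T) : nat := #|shortest_paths v w|.

Definition sigma_via (v w x : T) : nat :=
  #|[set p in shortest_paths v w | [&& x \in v :: p, x != v & x != w]]|.

(* Each unordered pair {v, w} of distinct vertices is represented once, by its
   ordering along the enumeration of T. *)
Definition betweenness (x : T) : rat :=
  \sum_(v : T) \sum_(w : T | (enum_rank v < enum_rank w)%N)
    (sigma_via v w x)%:R / (sigma v w)%:R.

Definition average_betweenness : rat :=
  (\sum_(x : T) betweenness x) / #|T|%:R.

Definition betweenness_uniform : Prop :=
  forall x y : T, betweenness x = betweenness y.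

End Graph.

(* Main.v *)
(** Counting internal vertices of shortest paths gives
    [sum_x B(x) = sum_{v,w} (d(v,w) - 1)], the sum being over unordered pairs,
    so it suffices that every vertex [v] satisfies
    [sum_(w <> v) (d(v,w) - 1) >= 2].
    If some [v] fails this, then, as the diameter is at least 3, [v] is adjacent
    to every vertex but one vertex [u], and [d(v,u) = 2]. A shortest path through
    [u] must then be [a u b] with [a], [b] adjacent to [v], so [a v b] is a
    shortest path as well, and [u] contributes nothing that [v] does not. But
    some [x] is at distance 3 from [u], and [v] lies on a shortest path from [u]
    to [x], so that [B(u) < B(v)], against uniformity. *)
Require Import Defs.
From mathcomp Require Import all_boot all_order all_algebra.
From mathcomp Require Import zify.

Set Implicit Arguments.
Unset Strict Implicit.
Unset Printing Implicit Defensive.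

Import Order.TTheory GRing.Theory Num.Theory.
Local Open Scope ring_scope.

(** Passing to ordered pairs lets the final bound be proved for each vertex separately. *)
Lemma sum_symmetric (T : finType) (f : T -> T -> nat) :
  (forall v w, f v w = f w v) -> (forall v, f v v = 0%N) ->
  (\sum_v \sum_w f v w =
   2 * \sum_v \sum_(w | (enum_rank v < enum_rank w)%N) f v w)%N.
Proof.
move=> fC f0; rewrite mul2n -addnn.
have -> : (\sum_v \sum_w f v w =
    \sum_v \sum_(w | (enum_rank v < enum_rank w)%N) f v w +
    \sum_v \sum_(w | (enum_rank w < enum_rank v)%N) f v w)%N.
  rewrite -big_split; apply: eq_bigr => v _ /=.
  rewrite (bigID (fun w => (enum_rank v < enum_rank w)%N)) /=; congr addn.
  rewrite (bigD1 v) ?ltnn //= f0 add0n; apply: eq_bigl => w.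
  rewrite -leqNgt ltn_neqAle andbC; congr andb.
  by rewrite (inj_eq val_inj) (inj_eq enum_rank_inj).
congr addn; rewrite [RHS](exchange_big_dep xpredT) //=.
by apply: eq_bigr => v _; apply: eq_bigr => w _.
Qed.

Section Graph.
Variables (T : finType) (e : rel T).
Hypothesis e_sym : symmetric e.
Hypothesis e_conn : connected_graph e.

Lemma path_between_size_lt v w p : path_between e v w p -> (size p < #|T|)%N.
Proof. by case/and3P=> _ _ /card_uniqP; rewrite /= => <-; apply: max_card. Qed.

(** The walk [p] may repeat vertices. Shortening it gives a simple path, whose length is below
    [#|T|] and so lies in the range searched by [dist]. *)
Lemma dist_le v w p : path e v p -> last v p = w -> (dist e v w <= size p)%N.
Proof.
move=> ep <-; case: (shortenP ep) => q eq uq /uniq_leq_size sq.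
have {}sq : (size q <= size p)%N by apply: sq; case/andP: uq.
apply: leq_trans sq.
have pq : path_between e v (last v q) q by rewrite /path_between eq eqxx uq.
rewrite leqNgt; apply/negP => /(before_find 0%N).
rewrite nth_iota ?(path_between_size_lt pq) // add0n.
by move=> /existsP[]; exists (in_tuple q).
Qed.

(** Connectedness excludes the junk value [#|T|]: the search stops at a length that is realised. *)
Lemma dist_path v w :
  exists p : (dist e v w).-tuple T, path_between e v w p.
Proof.
apply/existsP.
have has_len : has (fun n : nat => [exists p : n.-tuple T, path_between e v w p])
                (iota 0 #|T|).
  have /connectP[p0 ep0 ->] := e_conn v w.
  case: (shortenP ep0) => q eq uq _.
  have pq : path_between e v (last v q) q by rewrite /path_between eq eqxx uq.
  apply/hasP; exists (size q); first by rewrite mem_iota (path_between_size_lt pq).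
  by apply/existsP; exists (in_tuple q).
have := nth_find 0%N has_len; rewrite nth_iota; last first.
  by rewrite -[X in (_ < X)%N](size_iota 0 #|T|) -has_find.
by rewrite add0n.
Qed.

Lemma distxx v : dist e v v = 0%N.
Proof. by apply/eqP; rewrite -leqn0; apply: (@dist_le v v [::]). Qed.

Lemma dist_triangle u v w : (dist e u w <= dist e u v + dist e v w)%N.
Proof.
have [p /and3P[ep /eqP lp _]] := dist_path u v.
have [q /and3P[eq /eqP lq _]] := dist_path v w.
have := @dist_le u w (p ++ q); rewrite size_cat !size_tuple; apply.
  by rewrite cat_path ep lp.
by rewrite last_cat lp.
Qed.

Lemma distC v w : dist e v w = dist e w v.
Proof.
have dist_leC x y : (dist e x y <= dist e y x)%N.
  have [p /and3P[ep /eqP lp _]] := dist_path y x.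
  (* Paths omit their first vertex, so reversing one drops the last vertex of [y :: p] instead. *)
  have := @dist_le x y (rev (belast y p)).
  rewrite size_rev size_belast size_tuple; apply.
    by rewrite -[X in path _ X]lp rev_path (eq_path (e' := e)) // => a b; apply: e_sym.
  by case: (tval p) lp => [|a s] //= _; rewrite rev_cons last_rcons.
by apply/eqP; rewrite eqn_leq !dist_leC.
Qed.

Lemma dist_le1 v w : (dist e v w <= 1)%N -> v != w -> e v w.
Proof.
have [p] := dist_path v w; case/and3P=> ep /eqP lp _.
move: (size_tuple p) ep lp; case: (tval p) => [|a [|b s]] /= <- //.
  by move=> _ -> _; rewrite eqxx.
by rewrite andbT => ? <-.
Qed.

Lemma sigma_gt0 v w : (0 < sigma e v w)%N.
Proof. by have [p pP] := dist_path v w; apply/card_gt0P; exists p; rewrite inE. Qed.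

(** Double counting of pairs of a shortest path and an internal vertex of it. *)
Lemma sum_sigma_via v w : v != w ->
  (\sum_x sigma_via e v w x = sigma e v w * (dist e v w).-1)%N.
Proof.
move=> vw; rewrite /sigma -sum_nat_const.
under eq_bigr => x _.
  rewrite /sigma_via -sum1dep_card big_mkcondr /=; over.
rewrite exchange_big /=; apply: eq_bigr => p.
rewrite inE => /and3P[_ /eqP lp up].
rewrite -big_mkcond sum1dep_card.
have wp : w \in tval p by move: (mem_last v p); rewrite lp inE eq_sym (negPf vw).
have -> : [set x | [&& x \in v :: p, x != v & x != w]] = [set x in p] :\ w.
  apply/setP=> x; rewrite !inE.
  have [->|] := eqVneq x v; last by rewrite /= andbC.
  by move: up => /= /andP[/negPf-> _]; rewrite andbF.
have := cardsD1 w [set x in p]; rewrite inE wp cardsE.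
move: up => /= /andP[_ /card_uniqP ->] card_p.
by rewrite -[in RHS](size_tuple p) card_p.
Qed.

Lemma sum_betweenness :
  \sum_x betweenness e x =
  (\sum_v \sum_(w | (enum_rank v < enum_rank w)%N) (dist e v w).-1)%N%:R.
Proof.
rewrite exchange_big natr_sum; apply: eq_bigr => v _ /=.
rewrite exchange_big natr_sum; apply: eq_bigr => w vw /=.
have neq_vw : v != w by apply: contraTneq vw => ->; rewrite ltnn.
rewrite -mulr_suml -natr_sum sum_sigma_via // natrM mulrAC mulfV ?mul1r //.
by rewrite pnatr_eq0 -lt0n sigma_gt0.
Qed.

Lemma sigma_via_gt0 v w x p :
  path_between e v w p -> size p = dist e v w -> x \in p -> x != v -> x != w ->
  (0 < sigma_via e v w x)%N.
Proof.
move=> pP /eqP sp xp xv xw; apply/card_gt0P; exists (Tuple sp).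
by rewrite !inE pP xv xw xp orbT.
Qed.

(** Only one ordering of [a], [b] occurs in the sum. Assuming strictness for both spares the caller
    from comparing their ranks. *)
Lemma betweenness_lt u v a b :
  (forall x y, x != y -> sigma_via e x y u <= sigma_via e x y v)%N ->
  a != b ->
  (sigma_via e a b u < sigma_via e a b v)%N ->
  (sigma_via e b a u < sigma_via e b a v)%N ->
  betweenness e u < betweenness e v.
Proof.
move=> le_uv; wlog lt_ab : a b / (enum_rank a < enum_rank b)%N.
  move=> IH ab h1 h2; have := ltngtP (enum_rank a) (enum_rank b); case=> lt.
  - exact: (IH a b).
  - by apply: (IH b a); rewrite // eq_sym.
  - by move/val_inj/enum_rank_inj: lt ab => ->; rewrite eqxx.
move=> _ lt_uv _; rewrite /betweenness !pair_big_dep /=.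
rewrite (bigD1 (a, b)) //= [ltRHS](bigD1 (a, b)) //=.
apply: ltr_leD.
  by rewrite ltr_pM2r ?ltr_nat // invr_gt0 ltr0n sigma_gt0.
apply: ler_sum => -[x y] /= /andP[xy _].
rewrite ler_pM2r ?invr_gt0 ?ltr0n ?sigma_gt0 // ler_nat le_uv //.
by apply: contraTneq xy => ->; rewrite ltnn.
Qed.

(** If [u] is internal to a shortest path from [a] to [b], then [a] and [b] are nonadjacent and
    differ from [u]. Hence neither is [v], both are adjacent to [v], and their distance is 2. The
    left side then counts at most the path [a u b], and the right side at least [a v b]. *)
Lemma sigma_via_le_dominated u v : irreflexive e -> u != v ->
  (forall x, x != u -> x != v -> e v x) ->
  forall a b, a != b -> (sigma_via e a b u <= sigma_via e a b v)%N.
Proof.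
move=> e_irr uv vadj a b ab.
case: (posnP (sigma_via e a b u)) => [-> //|/card_gt0P[p]].
rewrite !inE => /andP[pP /and3P[up ua ub]].
have size_ge2 q : path_between e a b q -> u \in a :: q -> (2 <= size q)%N.
  case/and3P=> _ /eqP lq _; case: q lq => [|c [|d s]] //=.
    by rewrite inE (negPf ua).
  by move=> ->; rewrite !inE (negPf ua) (negPf ub).
have dge2 : (2 <= dist e a b)%N by rewrite -(size_tuple p) size_ge2.
have nonadj : ~~ e a b.
  apply: contraTN dge2 => eab; rewrite -ltnNge ltnS.
  by apply: (@dist_le a b [:: b]); rewrite //= eab.
have av : a != v.
  by apply: contraNneq nonadj => a_v; rewrite a_v vadj // -?a_v eq_sym.
have bv : b != v.
  by apply: contraNneq nonadj => ->; rewrite e_sym vadj // eq_sym.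
have eav : e a v by rewrite e_sym vadj // eq_sym.
have evb : e v b by rewrite vadj // eq_sym.
have d2 : dist e a b = 2%N.
  apply/eqP; rewrite eqn_leq dge2 andbT.
  by apply: (@dist_le a b [:: v; b]); rewrite //= eav evb.
apply: (@leq_trans 1); last first.
  apply: (@sigma_via_gt0 a b v [:: v; b]); rewrite ?d2 ?mem_head // 1?eq_sym //.
  by rewrite /path_between /= eav evb eqxx !inE negb_or av ab eq_sym bv.
have only q : q \in [set q in shortest_paths e a b | [&& u \in a :: q, u != a & u != b]] ->
    tval q = [:: u; b].
  rewrite !inE => /andP[/and3P[_ /eqP lq _] /and3P[uq _ _]].
  move: (size_tuple q) lq uq; rewrite {2}d2.
  case: (tval q) => [|c [|d [|? ?]]] //= _ ->.
  by rewrite !inE (negPf ua) (negPf ub) orbF /= => /eqP->.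
rewrite /sigma_via; apply/card_le1_eqP => q r /only qE /only rE.
by apply: val_inj; rewrite /= qE rE.
Qed.

Lemma sum_dist_ge2 v : irreflexive e -> betweenness_uniform e ->
  (3 <= diameter e)%N -> (2 <= \sum_w (dist e v w).-1)%N.
Proof.
move=> e_irr unif diam; rewrite leqNgt ltnS; apply/negP => sum_le1.
have [a [b ab]] : exists a b, (3 <= dist e a b)%N.
  have T_gt0 : (0 < #|T|)%N by apply/card_gt0P; exists v.
  move: diam; rewrite /diameter.
  have [a ->] := @bigop.eq_bigmax T (fun a => \max_w dist e a w)%N T_gt0.
  by have [b ->] := @bigop.eq_bigmax T (dist e a) T_gt0; exists a, b.
have [u du] : exists u, (1 < dist e v u)%N.
  apply/existsP; rewrite -[[exists _, _]]negbK negb_exists.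
  apply/negP => /forallP near.
  have := dist_triangle a v b; rewrite (distC a v).
  have := near a; have := near b; lia.
(* The term of [u] is at least 1 and uses up the whole sum, so every other term vanishes. *)
rewrite (bigD1 u) //= in sum_le1.
have near x : x != u -> (dist e v x <= 1)%N.
  by move=> xu; move: sum_le1; rewrite (bigD1 x) //=; lia.
have d2 : dist e v u = 2%N by lia.
have uv : u != v by apply: contraTneq du => ->; rewrite distxx.
have vadj x : x != u -> x != v -> e v x.
  by move=> xu xv; apply: dist_le1; [exact: near | rewrite eq_sym].
(* One of [a], [b] is [u]: otherwise both are within 1 of [v], hence within 2 of each other. *)
have [x dx] : exists x, (3 <= dist e u x)%N.
  have [<-|au] := eqVneq a u; first by exists b.
  have [<-|bu] := eqVneq b u; first by exists a; rewrite distC.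
  have := dist_triangle a v b; rewrite (distC a v).
  have := near _ au; have := near _ bu; lia.
have xu : x != u by apply: contraTneq dx => ->; rewrite distxx.
have xv : x != v by apply: contraTneq dx => ->; rewrite distC d2.
have evx := vadj x xu xv.
have [y evy eyu] : exists2 y, e v y & e y u.
  have [p /and3P[ep /eqP lp _]] := dist_path v u.
  move: (size_tuple p) ep lp; rewrite {2}d2.
  case: (tval p) => [|c [|d [|? ?]]] //= _ /and3P[evc ecd _] <-.
  by exists c.
have eyxN : ~~ e y x.
  apply: contraTN dx => eyx; rewrite -ltnNge ltnS.
  by apply: (@dist_le u x [:: y; x]); rewrite //= e_sym eyu eyx.
have yx : y != x.
  apply: contraTneq dx => <-; rewrite -ltnNge ltnS ltnW //.
  by apply: (@dist_le u y [:: y]); rewrite //= e_sym eyu.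
have yu : y != u by apply: contraTneq eyu => ->; rewrite e_irr.
have yv : y != v by apply: contraTneq evy => ->; rewrite e_irr.
have d3 : dist e u x = 3%N.
  apply/eqP; rewrite eqn_leq dx andbT.
  by apply: (@dist_le u x [:: y; v; x]); rewrite //= e_sym eyu (e_sym y) evy evx.
(* As an endpoint, [u] is never internal, while [v] is internal to [p]. This is applied to the path
   [u y v x] and its reverse. *)
have lt_uv c d p : path_between e c d p -> size p = 3%N -> dist e c d = 3%N ->
    v \in p -> v != c -> v != d -> (u == c) || (u == d) ->
    (sigma_via e c d u < sigma_via e c d v)%N.
  move=> pP sp dcd vp vc vd ucd.
  have -> : sigma_via e c d u = 0%N.
    by apply: eq_card0 => q; rewrite !inE -negb_or ucd !andbF.
  by apply: (sigma_via_gt0 pP); rewrite ?sp ?dcd.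
have : betweenness e u < betweenness e v; last by rewrite (unif u v) ltxx.
apply: (@betweenness_lt u v u x); first exact: sigma_via_le_dominated.
- by rewrite eq_sym.
- apply: (lt_uv _ _ [:: y; v; x]); rewrite ?inE ?eqxx ?orbT // 1?eq_sym //.
  rewrite /path_between /= (e_sym u) eyu (e_sym y) evy evx eqxx !inE !negb_or.
  by rewrite !(eq_sym u) yu (eq_sym v u) uv xu yv yx (eq_sym v) xv.
- apply: (lt_uv _ _ [:: v; y; u]); rewrite ?inE ?eqxx ?orbT // 1?distC 1?eq_sym //.
  rewrite /path_between /= (e_sym x) eyu evy evx eqxx !inE !negb_or.
  by rewrite xv (eq_sym x) yx xu (eq_sym v) yv (eq_sym v) uv yu.
Qed.

End Graph.

Theorem theorem7 (T : finType) (e : rel T)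
    (e_sym : symmetric e) (e_irr : irreflexive e) (T_gt0 : (0 < #|T|)%N)
    (e_conn : connected_graph e)
    (e_uniform : betweenness_uniform e)
    (e_diam : (3 <= diameter e)%N) :
  1 <= average_betweenness e.
Proof.
rewrite /average_betweenness ler_pdivlMr ?ltr0n // mul1r sum_betweenness // ler_nat.
(* After doubling, the target is [2 * #|T|], a contribution of 2 from each vertex. *)
rewrite -(leq_pmul2l (isT : (0 < 2)%N)) -sum_symmetric; last first.
- by move=> v; rewrite distxx.
- by move=> v w; rewrite distC.
rewrite mulnC -sum_nat_const; apply: leq_sum => v _.
exact: sum_dist_ge2.
Qed.
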